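(* For each $0<\alpha<1$ and each integer $d\ge2$, the subset $\mathsf{T}_d\setminus\mathcal{D}_{\alpha,d}$ is of the first Baire category.
   Context: $\mathsf{T}_d=(\mathbb{R}/\mathbb{Z})^d$ is identified with $[0,1)^d$. For a sequence $(x_n)_{n\in\mathbb{N}}$ in $[0,1)$ its (unnormalized) discrepancy at length $N$ is $$D_N=\sup_{0\le a<b\le1}\bigl|\#\{1\le n\le N:\ x_n\in(a,b)\}-(b-a)N\bigr|.$$ For $\mathbf{x}=(x_1,\dots,x_d)\in\mathsf{T}_d$, $D_d(\mathbf{x};N)$ denotes the discrepancy at length $N$ of the sequence of fractional parts of $x_1n+\dots+x_dn^d$, $n\in\mathbb{N}$. Define $$\mathcal{D}_{\alpha,d}=\{\mathbf{x}\in\mathsf{T}_d:\ D_d(\mathbf{x};N)\ge N^{\alpha}\text{ for infinitely many }N\in\mathbb{N}\}.$$ A subset of $\mathbb{R}^d$ is nowhere dense if its closure has empty interior, and is of the first Baire category if it is a countable union of nowhere dense sets. *)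

(* Defs.v *)
From mathcomp Require Import all_boot all_order all_algebra.
From mathcomp Require Import all_classical all_reals all_analysis.

Set Implicit Arguments.
Unset Strict Implicit.
Unset Printing Implicit Defensive.

Import Order.TTheory GRing.Theory Num.Theory.
Import numFieldNormedType.Exports.

Local Open Scope classical_set_scope.
Local Open Scope ring_scope.

Definition nowhere_dense (T : topologicalType) (A : set T) : Prop :=
  interior (closure A) = set0.

Definition first_category (T : topologicalType) (A : set T) : Prop :=
  exists F : nat -> set T,
    (forall k, nowhere_dense (F k)) /\ A = \bigcup_k F k.

Definition frac (R : realType) (t : R) : R := t - (Num.floor t)%:~R.

(* Only the terms [u 1], ..., [u N] are used.  The set below is nonempty and
   bounded above by [N], so its real-valued [sup] is a true supremum. *)
Definition discrepancy (R : realType) (u : nat -> R) (N : nat) : R :=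
  sup [set r : R | exists a b : R, [/\ 0 <= a, a < b, b <= 1 &
    r = `|(count (fun n => a < u n < b) (iota 1 N))%:R - (b - a) * N%:R|]].

Definition torus (R : realType) (d : nat) : set 'rV[R]_d :=
  [set x | forall j : 'I_d, 0 <= x 0 j < 1].

(* [j] starts at 0, so the entry [x 0 j] is the coefficient of [n ^ (j + 1)]. *)
Definition weyl_poly (R : realType) (d : nat) (x : 'rV[R]_d) (n : nat) : R :=
  \sum_(j < d) x 0 j * n%:R ^+ j.+1.

Definition poly_discrepancy (R : realType) (d : nat) (x : 'rV[R]_d) (N : nat) : R :=
  discrepancy (fun n => frac (weyl_poly x n)) N.

Definition large_discrepancy_set (R : realType) (alpha : R) (d : nat) :
    set 'rV[R]_d :=
  [set x | torus x /\ infinite_set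
    [set N : nat | (0 < N)%N /\ N%:R `^ alpha <= poly_discrepancy x N]].

(* Main.v *)
Require Import Defs.
From mathcomp Require Import all_boot all_order all_algebra.
From mathcomp Require Import all_classical all_reals all_analysis.
From mathcomp Require Import lra zify.
Import Order.TTheory GRing.Theory Num.Theory.
Import numFieldNormedType.Exports.
Local Open Scope classical_set_scope.
Local Open Scope ring_scope.

(** The discrepancy is already enormous near every rational point.  If all the
    coordinates of [z] are multiples of [1 / q], then so are all the values of
    the Weyl polynomial at [z], so the sequence of its fractional parts misses
    the interval (0, 1 / q) altogether.  Fixing [N], the first [N] terms of the
    sequence depend continuously on the coefficients; hence for every [y] close
    enough to [z] they still miss the middle half (1 / 4q, 3 / 4q) of that
    interval, and the discrepancy at length [N] is at least [N / 2q]
    ([large_discrepancy_near_rational]).  Since [alpha < 1], this exceeds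
    [N ^ alpha] once [N] is large ([powR_le_linear]).

    So, for each [k], the points whose discrepancy reaches [N ^ alpha] for some
    [N > k] contain a neighbourhood of each rational point.  Rational points
    being dense ([rational_rows_dense]), the points for which this fails form a
    nowhere dense set, and the complement of the large discrepancy set is the
    union of these sets over [k]. *)

Lemma discrepancy_has_ubound {R : realType} (u : nat -> R) (N : nat) :
  has_ubound [set r : R | exists a b : R, [/\ 0 <= a, a < b, b <= 1 &
    r = `|(count (fun n => a < u n < b) (iota 1 N))%:R - (b - a) * N%:R|]].
Proof.
exists N%:R => _ [a [b [a0 ab b1 ->]]].
have cN : (count (fun n => a < u n < b)%R (iota 1 N) <= N)%N.
  by rewrite -[leqRHS](size_iota 1) count_size.
have {cN} : (count (fun n => a < u n < b) (iota 1 N))%:R <= N%:R :> R.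
  by rewrite ler_nat.
move: (ler0n R N) (ler0n R (count (fun n => a < u n < b) (iota 1 N))).
move: (count _ _)%:R => c N0 c0 cN.
have : 0 <= (b - a) * N%:R by apply: mulr_ge0 => //; lra.
have : (b - a) * N%:R <= 1 * N%:R by apply: ler_wpM2r => //; lra.
by rewrite ler_norml => *; apply/andP; split; lra.
Qed.

Lemma discrepancy_ge_gap {R : realType} (u : nat -> R) (N : nat) (a b : R) :
  0 <= a -> a < b -> b <= 1 ->
  (forall n, (n <= N)%N -> ~~ (a < u n < b)) ->
  (b - a) * N%:R <= discrepancy u N.
Proof.
move=> a0 ab b1 gap.
apply: (ub_le_sup (discrepancy_has_ubound u N)).
exists a, b; split => //.
have /eqP -> : count (fun n => a < u n < b) (iota 1 N) == 0%N.
  rewrite -leqn0 leqNgt -has_count; apply/hasPn => n.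
  by rewrite mem_iota => nN; apply: gap; lia.
rewrite sub0r normrN ger0_norm // mulr_ge0 //; lra.
Qed.

(** A gap survives in the fractional parts because the interval (0, 1) contains
    no integer: were [t - floor t] in the middle half of (0, 1 / q), then
    [m / q - floor t] would be a multiple of [1 / q] in (0, 1 / q). *)
Lemma frac_near_multiple {R : realType} (q : nat) (m : int) (t : R) :
  (0 < q)%N -> `|m%:~R / q%:R - t| < q%:R^-1 / 4 ->
  ~~ (q%:R^-1 / 4 < Defs.frac t < 3 * (q%:R^-1 / 4)).
Proof.
move=> q0; have qR : 0 < q%:R :> R by rewrite ltr0n.
rewrite /Defs.frac ltr_norml => /andP[h1 h2]; apply/negP => /andP[h3 h4].
set f := Num.floor t in h3 h4 *.
have qK : q%:R * q%:R^-1 = 1 :> R by rewrite divff // gt_eqF.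
have [g1 g2] : 0 < m%:~R / q%:R - f%:~R :> R /\
    m%:~R / q%:R - f%:~R < q%:R^-1 :> R by lra.
have E : q%:R * (m%:~R / q%:R - f%:~R) = (m - f * q%:Z)%:~R :> R.
  by rewrite mulrBr mulrCA qK mulr1 rmorphB rmorphM /= mulrC.
have : 0 < (m - f * q%:Z)%:~R :> R by rewrite -E mulr_gt0.
have : (m - f * q%:Z)%:~R < 1%:~R :> R.
  by rewrite -E -[ltRHS]qK ltr_pM2l.
by rewrite ltr_int ltr0z; lia.
Qed.

Lemma weyl_poly_rational {R : realType} (d q : nat) (p : 'I_d -> int) (n : nat) :
  weyl_poly (\row_j ((p j)%:~R / q%:R) : 'rV[R]_d) n =
  (\sum_(j < d) p j * n%:Z ^+ j.+1)%:~R / q%:R.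
Proof.
rewrite /weyl_poly rmorph_sum mulr_suml; apply: eq_bigr => j _ /=.
by rewrite mxE rmorphM rmorphXn /= mulrAC.
Qed.

Lemma weyl_poly_continuous {R : realType} (d n : nat) :
  continuous (fun x : 'rV[R]_d => weyl_poly x n).
Proof.
apply: continuous_big; first exact: add_continuous.
move=> j _ x; exact: (@cvgMr_tmp R _ (nbhs x) _
  (fun y : 'rV[R]_d => y 0 j) _ _ (@coord_continuous R 1 d 0 j x)).
Qed.

Lemma large_discrepancy_near_rational {R : realType} (d q N : nat)
    (p : 'I_d -> int) : (0 < q)%N ->
  \forall y \near (\row_j ((p j)%:~R / q%:R) : 'rV[R]_d),
    q%:R^-1 / 2 * N%:R <= poly_discrepancy y N.
Proof.
move=> q0; set z := (\row_j _ : 'rV[R]_d).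
have qR : 0 < (q%:R : R)^-1 by rewrite invr_gt0 ltr0n.
have q1 : (q%:R : R)^-1 <= 1 by rewrite invf_le1 ?ltr0n // ler1n.
have near_z : \forall y \near z, forall n : 'I_N.+1,
    `|weyl_poly z n - weyl_poly y n| < q%:R^-1 / 4.
  apply: (@filter_forall _ _ (fun n : 'I_N.+1 =>
    [set y | `|weyl_poly z n - weyl_poly y n| < q%:R^-1 / 4])
    (nbhs z) _) => n.
  have /cvgrPdist_lt cvg_n := @weyl_poly_continuous R d n z.
  by apply: cvg_n; lra.
apply: filterS near_z => y zy.
have -> : (q%:R : R)^-1 / 2 = 3 * (q%:R^-1 / 4) - q%:R^-1 / 4 by lra.
apply: discrepancy_ge_gap; try lra.
move=> n nN; have := zy (Ordinal (nN : (n < N.+1)%N)).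
by rewrite weyl_poly_rational; exact: frac_near_multiple.
Qed.

(** Rounding all the coordinates down to multiples of one [1 / q] gives the
    approximation with a common denominator directly. *)
Lemma rational_rows_dense {R : realType} (d : nat) (x : 'rV[R]_d) (e : R) :
  0 < e -> exists (q : nat) (p : 'I_d -> int),
    (0 < q)%N /\ ball x e (\row_j ((p j)%:~R / q%:R) : 'rV[R]_d).
Proof.
move=> e0; have eV : 0 <= e^-1 by rewrite invr_ge0 ltW.
have eq := archi_boundP eV; set q := Num.bound e^-1 in eq.
have qR : 0 < q%:R :> R by apply: le_lt_trans eq.
have {}eq : q%:R^-1 < e by rewrite invf_plt.
exists q, (fun j => Num.floor (q%:R * x 0 j)); split; first by rewrite ltr0n in qR.
split=> // i j; rewrite mxE (ord1 i).
have /andP[] := floor_itv (q%:R * x 0 j).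
rewrite rmorphD /= -ler_pdivrMl // => f1 f2.
have {}f2 : x 0 j < q%:R^-1 * ((Num.floor (q%:R * x 0 j))%:~R + 1).
  by rewrite ltr_pdivlMl.
by rewrite /ball /= ltr_norml mulrC; apply/andP; split; lra.
Qed.

Lemma powR_le_linear {R : realType} (alpha c : R) (k : nat) :
  alpha < 1 -> 0 < c ->
  exists N : nat, (k < N)%N /\ N%:R `^ alpha <= c * N%:R.
Proof.
move=> a1 c0; have b0 : 0 < 1 - alpha by lra.
(* [A] is where [N ^ (1 - alpha)] reaches [1 / c]. *)
set A : R := c^-1 `^ (1 - alpha)^-1.
have A0 : 0 <= A by exact: powR_ge0.
have := archi_boundP A0; set M := Num.bound A => AM.
exists (k + M).+1; split; first by lia.
set N := (k + M).+1; have NR : 0 < N%:R :> R by rewrite ltr0n.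
have AN : A <= N%:R by apply: le_trans (ltW AM) _; rewrite ler_nat; lia.
have cN : c^-1 <= N%:R `^ (1 - alpha).
  have <- : A `^ (1 - alpha) = c^-1.
    by rewrite -powRrM mulVf ?gt_eqF // powRr1 // invr_ge0 ltW.
  by apply: ge0_ler_powR; rewrite ?nnegrE // ltW.
have {2}-> : N%:R = N%:R `^ (1 - alpha) * N%:R `^ alpha :> R.
  by rewrite -powRD ?(gt_eqF NR) ?implybT // subrK powRr1 // ltW.
rewrite mulrA ler_peMl ?powR_ge0 //.
by rewrite -[leLHS](divff (lt0r_neq0 c0)) ler_pM2l.
Qed.

Lemma infinite_natP (A : set nat) :
  infinite_set A <-> forall k, exists n, (k < n)%N /\ A n.
Proof.
split=> [infA k|unbA finA].
  apply: contrapT => none; apply: infA.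
  apply: (sub_finite_set _ (finite_II k.+1)) => n An /=.
  by rewrite ltnS leqNgt; apply/negP => kn; apply: none; exists n.
have /finite_seqP[s As] := finA.
have [n [sn An]] := unbA (\max_(i <- s) i)%N.
have ns : n \in s by move: An; rewrite As.
have := leq_bigmax_seq (P := xpredT) (F := id) n ns isT.
by rewrite leqNgt sn.
Qed.

Theorem theorem1p9 (R : realType) (alpha : R) (d : nat)
    (alpha_gt0 : 0 < alpha) (alpha_lt1 : alpha < 1) (d_ge2 : (2 <= d)%N) :
  first_category (@torus R d `\` @large_discrepancy_set R alpha d).
Proof.
pose large (x : 'rV[R]_d) (N : nat) :=
  (0 < N)%N /\ N%:R `^ alpha <= poly_discrepancy x N.
exists (fun k => @torus R d `&` [set x | forall N, (k < N)%N -> ~ large x N]).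
split=> [k|].
  (* A ball inside the closure would contain a rational point, hence meet the
     set itself inside the neighbourhood where the discrepancy is large. *)
  apply/seteqP; split=> // x /nbhs_ballP[e /= e0 xe].
  have [q [p [q0 /xe zF]]] := @rational_rows_dense R d x e e0.
  have c0 : 0 < (q%:R : R)^-1 / 2 by rewrite divr_gt0 // invr_gt0 ltr0n.
  have [N [kN NN]] := powR_le_linear _ _ k alpha_lt1 c0.
  have [y [[_ Fy] zy]] :=
    zF _ (large_discrepancy_near_rational d q N p q0).
  by apply: (Fy N kN); split; [lia | exact: le_trans zy].
apply/seteqP; split=> x.
  move=> [tx nlarge]; apply: contrapT => nF; apply: nlarge; split=> //.
  apply/infinite_natP => k; apply: contrapT => none; apply: nF.
  exists k => //; split=> // N kN largeN; apply: none; by exists N.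
move=> [k _ [tx Fx]]; split=> // -[_ /infinite_natP /(_ k) [N [kN largeN]]].
exact: Fx N kN largeN.
Qed.
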